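(* Let $R$ be a countably infinite relational structure with domain $E$. If $R$ is monomorphic and uniformly prehomogeneous, and $\mathrm{Aut}(R)$ is not the full symmetric group on $E$, then $\mathrm{sib}(R)=2^{\aleph_0}$.
   Context: A relational structure with domain $E$ is $R=(E,(\rho_i)_{i\in I})$ with $\rho_i\subseteq E^{n_i}$. For $A\subseteq E$, $R_{\restriction A}=(A,(A^{n_i}\cap\rho_i)_{i\in I})$. A local isomorphism of $R$ is an isomorphism from a restriction $R_{\restriction F}$ onto a restriction $R_{\restriction F'}$. A structure $S$ embeds into $R$ if $S$ is isomorphic to a restriction of $R$. A sibling of $R$ is a structure $S$ such that $S$ embeds into $R$ and $R$ embeds into $S$; $\mathrm{sib}(R)$ is the number of siblings up to isomorphism. $R$ is monomorphic if for every non-negative integer $p$ all restrictions of $R$ to $p$-element subsets are isomorphic. $R$ is prehomogeneous if for every finite $F\subseteq E$ there is a finite $F'\supseteq F$, $F'\subseteq E$, such that every local isomorphism of $R$ with domain $F$ extends to an automorphism of $R$ provided that it extends to a local isomorphism with domain $F'$. It is uniformly prehomogeneous if in addition $|F'|$ can be bounded by $\theta(|F|)$ for some function $\theta$. *)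

(* Defs.v *)
From mathcomp Require Import all_boot.
From mathcomp Require Import all_classical.

Set Implicit Arguments.
Unset Strict Implicit.
Unset Printing Implicit Defensive.

Local Open Scope classical_set_scope.
Local Open Scope card_scope.

(* The signature is an arbitrary index type I with arities n; E^m is the type
   'I_m -> E. *)
Record structure (I : Type) (n : I -> nat) := Structure {
  dom :> Type;
  rho : forall i : I, set ('I_(n i) -> dom) }.
Arguments rho {I n} _ i _.

Section RelationalStructures.
Variables (I : Type) (n : I -> nat).
Implicit Types R S T : structure n.

(* The domain is a sig type rather than [set_type A]: the universe of
   [set_type] has to stay above that of [structure n], because cardinals of
   sets of isomorphism classes of structures are considered below. *)
Definition restriction R (A : set R) : structure n :=
  @Structure I n {x : R | x \in A} (fun i => [set t | rho R i (sval \o t)]).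

Definition incl R (A : set R) (x : restriction A) : R := sval x.

Definition isomorphism R S (f : R -> S) : Prop :=
  bijective f /\ forall i (t : 'I_(n i) -> R), rho R i t <-> rho S i (f \o t).

Definition isomorphic R S : Prop := exists f : R -> S, isomorphism f.

Definition embeds S R : Prop := exists A : set R, isomorphic S (restriction A).

Definition sibling R S : Prop := embeds S R /\ embeds R S.

Definition iso_class S : set (structure n) := [set T | isomorphic S T].

Definition sib R : set (set (structure n)) := iso_class @` [set S | sibling R S].

Definition Aut R : set (R -> R) := [set f | isomorphism f].
#[global] Arguments Aut R _ : clear implicits.

Definition monomorphic R : Prop :=
  forall (p : nat) (A B : set R),
    A #= `I_p -> B #= `I_p -> isomorphic (restriction A) (restriction B).

Definition extends_to_automorphism R (F G : set R)
    (f : restriction F -> restriction G) : Prop :=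
  exists2 g : R -> R, Aut R g & forall x, g (incl x) = incl (f x).

Definition extends_to_local_isomorphism R (F G : set R)
    (f : restriction F -> restriction G) (F' : set R) : Prop :=
  exists (G' : set R) (h : restriction F' -> restriction G'),
    isomorphism h /\
    forall x y, incl x = incl y -> incl (h y) = incl (f x).

Definition controls R (F F' : set R) : Prop :=
  forall (G : set R) (f : restriction F -> restriction G),
    isomorphism f ->
    extends_to_local_isomorphism f F' -> extends_to_automorphism f.

Definition prehomogeneous R : Prop :=
  forall F : set R, finite_set F ->
  exists F' : set R, [/\ F `<=` F', finite_set F' & controls F F'].

Definition uniformly_prehomogeneous R : Prop :=
  exists theta : nat -> nat, forall (m : nat) (F : set R), F #= `I_m ->
  exists F' : set R, [/\ F `<=` F', F' #<= `I_(theta m) & controls F F'].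

End RelationalStructures.

(* Main.v *)
Require Import Defs.
From mathcomp Require Import all_boot order all_algebra.
From mathcomp Require Import all_classical.
From mathcomp Require Import zify lra.

(** Every sibling of [R] is isomorphic to a restriction of [R], and a countable
    domain has only continuum many subsets; the point is to find continuum many
    pairwise non-isomorphic siblings.

    They are all cut out of one structure [M = stretch U e0] on the chain
    [rat *l nat] (lexicographic product).  Fix a nonprincipal ultrafilter [U] on
    the domain of [R].  A relation holds in [M] at a tuple [t] when, listing the
    entries of [t] in increasing order c_1 < ... < c_p, it holds in [R] for
    U-almost all values of c_1, for U-almost all values of c_2, and so on.  So
    [M] is chained by its order: truth depends only on the order pattern of [t]
    ([stretch_pattern]).  By monomorphy the points of a p-element subset of [R],
    once labelled, realize one of finitely many labelled structures, hence one of
    these is generic, and each finite restriction of [M] is found inside [R]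
    ([stretch_realized]).

    [R] and [M] embed in each other by the same compactness argument
    ([extension]): if finite partial maps fall into finitely many types that
    support the forth step of a back-and-forth, then arbitrarily long partial
    embeddings give an embedding.  For [M] into [R] the types are the orbits of
    Aut(R), finitely many in each length by uniform prehomogeneity and monomorphy
    ([same_orbit_finite]); for [R] into [M] they are the order patterns of finite
    sequences of rationals, and the image lies in the rationals times 0.  It
    follows that the restriction of [M] to any set containing the rationals times
    0 is a sibling of [R].

    To tell such restrictions apart without classifying the possible groups
    Aut(R), call [x] and [y] twins when replacing [x] by [y] and fixing all other
    points is an isomorphism from the complement of [y] onto the complement of
    [x].  Consecutive points of the chain are twins ([consecutive_twins]).  On the
    other hand, suppose that [x < y] are twins with different rational coordinates.
    Some [z] lies between them, and arbitrarily many points lie on either side;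
    replacing [x] by [y] turns [x < z] into [z < y], so that two neighbours at any
    position of any increasing sequence can be exchanged without changing the
    type.  Neighbour exchanges generate all permutations, so [M] would be totally
    symmetric and every permutation of the domain of [R] would be an automorphism
    ([swap_invariant_symmetric]), contrary to hypothesis.  An isomorphism between
    two restrictions of [M] thus maps each fibre of the first projection into a
    fibre.  Giving the fibre over the natural number [m] size [m + 2] when [m]
    lies in [S], and every other fibre size 1, makes [S] an isomorphism
    invariant ([blocks_subset]). *)

Set Implicit Arguments.
Unset Strict Implicit.
Unset Printing Implicit Defensive.

Import Order.TTheory GRing.Theory Num.Theory.

Local Open Scope classical_set_scope.
Local Open Scope card_scope.

Local Notation L := (rat *l nat)%type.

(** * Finite sequences, enumerations and the lexicographic chain *)

Definition upd (N : eqType) (E : Type) (v : N -> E) (c : N) (x : E) : N -> E :=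
  fun d => if d == c then x else v d.

Definition agree (T : Type) k (v w : nat -> T) := forall i, i < k -> v i = w i.

Lemma inj_surj_bijective (S T : Type) (f : S -> T) :
  injective f -> (forall y, exists x, f x = y) -> bijective f.
Proof.
move=> finj /choice[g gK]; exists g => // x.
by apply: finj; rewrite gK.
Qed.

Lemma factor_through (J : finType) (L : eqType) (T : Type) (x0 : T)
    (t : J -> L) (t' : J -> T) :
  (forall j k, t j = t k -> t' j = t' k) -> exists h : L -> T, h \o t = t'.
Proof.
move=> tt'; exists (fun c => if [pick j | t j == c] is Some j then t' j else x0).
apply/funext => j /=; case: pickP => [k /eqP/tt'//|/(_ j)].
by rewrite eqxx.
Qed.

(** The renaming that sends the entries of [l], in order, to those of [s]. *)
Lemma map_nth_index (N : eqType) (T : Type) (x : T) (l : seq N) (s : seq T) :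
  uniq l -> size l = size s -> [seq nth x s (index c l) | c <- l] = s.
Proof.
case: l => [|c0 l]; first by case: s.
move=> ul sl; apply: (@eq_from_nth _ x); first by rewrite size_map.
move=> i; rewrite size_map => il.
by rewrite (nth_map c0)// index_uniq.
Qed.

Lemma inj_of_uniq_map (N N' : eqType) (h : N -> N') (s : seq N) :
  uniq (map h s) -> {in s &, injective h}.
Proof.
move=> us c d cs ds hcd; apply: (index_inj _ cs) => //; apply/eqP.
rewrite -(@nth_uniq _ (h c) (map h s)) ?size_map ?index_mem//.
by rewrite !(nth_map c) ?index_mem// !nth_index// hcd.
Qed.

(** Bubble sort: exchanging neighbours moves one entry across a block, hence one
    block across another, which is the step of [catCA_perm_ind]. *)
Lemma perm_ind_adjacent (N : eqType) (P : seq N -> Prop) :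
  (forall s1 u v s2, P (s1 ++ u :: v :: s2) -> P (s1 ++ v :: u :: s2)) ->
  forall s s', perm_eq s s' -> P s -> P s'.
Proof.
move=> Padj; have Pins s0 u s1 s2 : P (s0 ++ u :: s1 ++ s2) -> P (s0 ++ s1 ++ u :: s2).
  elim: s1 s0 => [//|v s1 IHs] s0 /Padj.
  by rewrite -cat_rcons => /IHs; rewrite cat_rcons.
apply: catCA_perm_ind => s1 s2 s3.
suff H s0 : P (s0 ++ s1 ++ s2 ++ s3) -> P (s0 ++ s2 ++ s1 ++ s3) by exact: (H [::]).
elim: s1 s0 => [//|u s1 IHs] s0.
by rewrite -cat_rcons => /IHs; rewrite cat_rcons; exact: Pins.
Qed.

(** Infinite pigeonhole principle.  If each colour [k] failed at some [m k], then
    all colours would fail at the maximum of the [m k]. *)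
Lemma antitone_pigeonhole (F : finType) (Q : F -> nat -> Prop) :
  (forall k m m', m <= m' -> Q k m' -> Q k m) ->
  (forall m, exists k, Q k m) -> exists k, forall m, Q k m.
Proof.
move=> Qanti Qex; apply: contrapT => /forallNP nQ.
have /choice[m nQm] k : exists m, ~ Q k m.
  by apply: contrapT => /forallNP nnQ; apply: (nQ k) => m; apply: contrapT.
have [k Qk] := Qex (\max_k m k).
by apply: (nQm k); apply: Qanti Qk; exact: leq_bigmax.
Qed.

(** Adds points of [F] one at a time; the bound on the size of [F] makes this
    stop. *)
Lemma extend_enumeration (T : Type) (F : set T) b k (v : nat -> T) :
  F #<= `I_b -> set_inj `I_k v -> v @` `I_k `<=` F ->
  exists p w, [/\ k <= p <= b, agree k w v, set_inj `I_p w & w @` `I_p = F].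
Proof.
move=> Fb.
have kb j (x : nat -> T) : set_inj `I_j x -> x @` `I_j `<=` F -> j <= b.
  move=> xinj xF; rewrite -card_le_II.
  have /card_eqPle[_ Ix] := inj_card_eq xinj.
  by apply: card_le_trans Ix _; apply: card_le_trans (subset_card_le xF) Fb.
elim: {k}(b - k).+1 {-2}k (ltnSn (b - k)) v => [//|m IHm] k km v vinj vF.
have kleb := kb _ _ vinj vF.
have [Fv|/existsNP[x /not_implyP[Fx nvx]]] := pselect (F `<=` v @` `I_k).
  by exists k, v; split=> //; [rewrite leqnn | apply/seteqP].
have xv i : i < k -> v i <> x by move=> ik vx; apply: nvx; exists i.
have uinj : set_inj `I_k.+1 (upd v k x).
  move=> i j; rewrite !inE /= !ltnS /upd.
  case: (eqVneq i k) => [->|ik]; case: (eqVneq j k) => [->//|jk] ik' jk'.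
  - by move=> /esym /xv; lia.
  - by move=> /xv; lia.
  - by apply: vinj; rewrite inE /=; lia.
have uF : upd v k x @` `I_k.+1 `<=` F.
  move=> _ [i /= ik <-]; rewrite /upd; case: eqVneq => // ik'.
  by apply: vF; exists i => //=; lia.
have ltkb := kb _ _ uinj uF.
have [|p [w [/andP[kp pb] wu winj wF]]] := IHm _ _ _ uinj uF; first lia.
exists p, w; split=> //; first by rewrite pb andbT ltnW.
by move=> i ik; rewrite wu ?/upd ?ltn_eqF//; lia.
Qed.

(** Density of the rationals without endpoints, for finite cuts whose sides may
    be empty. *)
Lemma rat_between (lo hi : seq rat) :
  (forall a b, a \in lo -> b \in hi -> (a < b)%R) ->
  exists y, (forall a, a \in lo -> (a < y)%R) /\ (forall b, b \in hi -> (y < b)%R).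
Proof.
have above (a : rat) (bs : seq rat) : (forall b, b \in bs -> (a < b)%R) ->
    exists2 y, (a < y)%R & forall b, b \in bs -> (y < b)%R.
  elim: bs => [|b bs IHb] abs; first by exists (a + 1)%R => //; lra.
  have [|y ay yb] := IHb; first by move=> c cb; apply: abs; rewrite inE cb orbT.
  have ab := abs b (mem_head _ _).
  have [yltb|bley] := ltP y b.
    by exists y => // c; rewrite inE => /predU1P[->//|/yb].
  exists ((a + b) / 2)%R; first lra.
  by move=> c; rewrite inE => /predU1P[->|/yb]; lra.
elim: lo => [|a lo IHlo] lohi.
  have [|m _ mP] := above (- \sum_(b <- hi) `|b| - 1)%R hi; last by exists m.
  move=> b bh; rewrite (big_rem b)//=.
  have : (0 <= \sum_(c <- rem b hi) `|c|)%R by apply: sumr_ge0.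
  by have := ler_norm (- b)%R; rewrite normrN; lra.
have [|y [ly yh]] := IHlo.
  by move=> c b cl bh; apply: lohi; rewrite // inE cl orbT.
have [ay|ya] := ltP a y.
  by exists y; split=> // c; rewrite inE => /predU1P[->//|/ly].
have [|z az zh] := above a hi; first by move=> b; apply: lohi; exact: mem_head.
exists z; split=> // c; rewrite inE => /predU1P[->//|/ly]; lra.
Qed.

Lemma ltLE (c d : L) :
  (c < d)%O = (c.1 < d.1)%R || ((c.1 == d.1) && (c.2 < d.2)).
Proof.
case: c d => [q k] [q' k']; rewrite Order.ProdLexiOrder.ltEprodlexi ltEnat /=.
by case: ltgtP.
Qed.

(** The rationals have no least element; the new points are taken with second
    coordinate 0 so that they lie in every restriction considered below. *)
Lemma extend_left m (c : L) l : sorted <%O (c :: l) ->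
  exists a : seq L, [/\ size a = m, sorted <%O (a ++ c :: l) &
    forall d, d \in a -> d.2 = 0].
Proof.
elim: m c l => [|m IHm] c l scl; first by exists [::].
pose c' : L := ((c.1 - 1)%R, 0).
have [|a [sa ss a0]] := IHm c' (c :: l).
  by apply/andP; split=> //; rewrite ltLE /=; apply/orP; left; lra.
exists (rcons a c'); split; rewrite ?size_rcons ?sa ?cat_rcons// => d.
by rewrite mem_rcons inE => /predU1P[->|/a0].
Qed.

Lemma extend_right m (c : L) l : sorted <%O (rcons l c) ->
  exists b : seq L, [/\ size b = m, sorted <%O (l ++ c :: b) &
    forall d, d \in b -> d.2 = 0].
Proof.
elim: m c l => [|m IHm] c l slc; first by exists [::]; rewrite cats1.
pose c' : L := ((c.1 + 1)%R, 0).
have [|b [sb ss b0]] := IHm c' (rcons l c).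
  have cc' : (c < c')%O by rewrite ltLE /=; apply/orP; left; lra.
  case: l slc => [|d l] /= slc; first by rewrite cc'.
  by rewrite rcons_path slc last_rcons.
exists (c' :: b); split; [by rewrite /= sb | by rewrite -cat_rcons | move=> d].
by rewrite inE => /predU1P[->|/b0].
Qed.

Lemma enumeration (T : Type) : [set: T] #= [set: nat] ->
  exists r : nat -> T, bijective r.
Proof.
move=> /card_set_bijP[f]; rewrite setTT_bijective => -[r fr rf].
by exists r, f.
Qed.

Lemma lexQ_enumeration : exists s : nat -> rat * nat, bijective s.
Proof.
have [q [q' qq' q'q]] := enumeration card_rat.
have [p [p' pp' p'p]] := enumeration card_nat2.
exists (fun i => (q (p i).1, (p i).2)), (fun c => p' (q' c.1, c.2)) => [i|[c k]] /=.
  by rewrite qq' -surjective_pairing pp'.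
by rewrite p'p /= q'q.
Qed.

Lemma card_set_of_sets (T : Type) :
  [set: T] #= [set: nat] -> [set: set T] #<= [set: set nat].
Proof.
move=> /enumeration[r [r' rr' r'r]].
have finj : injective (fun A : set T => r @^-1` A).
  move=> A B AB; apply/predeqP => x.
  by have := congr1 (fun C => C (r' x)) AB; rewrite /preimage /= r'r => ->.
by apply/pcard_leTP; apply/injPex; exists (fun A : set T => r @^-1` A); exact: in2W.
Qed.

(** * Embeddings, isomorphisms and labelled types *)

Section Structures.
Variables (I : Type) (n : I -> nat).
Implicit Types R S T : structure n.

(** [v] and [w] give the points named by [D] the same labelled structure.  This
    keeps local isomorphisms as plain functions on names, without the sig types
    of [restriction]. *)
Definition same_type R T (N : Type) (D : set N) (v : N -> R) (w : N -> T) :=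
  forall i (t : 'I_(n i) -> N), (forall j, D (t j)) ->
    rho R i (v \o t) <-> rho T i (w \o t).

Definition embedding S T (f : S -> T) :=
  injective f /\ forall i t, rho S i t <-> rho T i (f \o t).

Lemma embedsP S T : embeds S T <-> exists f : S -> T, embedding f.
Proof.
split=> [[A [f [fbij fP]]]|[f [finj fP]]].
  exists ((fun x : restriction A => sval x) \o f); split=> //.
  by apply: inj_comp (bij_inj fbij) => x y; exact: val_inj.
have fA x : f x \in range f by rewrite inE; exists x.
exists (range f), (fun x => exist _ (f x) (fA x)); split=> //.
apply: inj_surj_bijective => [x y [] /finj//|[y yA]].
have [x _ xy] := set_mem yA; exists x.
by move: yA; rewrite -xy => yA; congr exist; exact: bool_irrelevance.
Qed.

Lemma embedding_comp R S T (f : R -> S) (g : S -> T) :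
  embedding f -> embedding g -> embedding (g \o f).
Proof.
move=> [fi fP] [gi gP]; split=> [|i t]; first exact: inj_comp.
by rewrite fP gP.
Qed.

Lemma embedding_sval R (A : set R) : embedding (fun x : restriction A => sval x : R).
Proof.
split=> // x y; exact: val_inj.
Qed.

Lemma iso_inv S T (f : S -> T) : isomorphism f ->
  exists2 g : T -> S, isomorphism g & cancel f g /\ cancel g f.
Proof.
move=> [[g fK gK] fP]; exists g; last by [].
split=> [|i t]; first by exists f.
rewrite fP (_ : f \o (g \o t) = t)//.
by apply/funext => j /=; rewrite gK.
Qed.

Lemma isomorphic_sym S T : isomorphic S T -> isomorphic T S.
Proof. by move=> [f /iso_inv[g gi _]]; exists g. Qed.

Lemma isomorphic_trans R S T : isomorphic R S -> isomorphic S T -> isomorphic R T.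
Proof.
move=> [f [fbij fP]] [g [gbij gP]]; exists (g \o f); split=> [|i t].
  exact: bij_comp.
by rewrite fP gP.
Qed.

Lemma iso_class_eq S T : iso_class S = iso_class T <-> isomorphic S T.
Proof.
split=> [eST|ST].
  rewrite -[isomorphic S T]/(iso_class S T) eST.
  by exists id; split=> //; exists id.
rewrite /iso_class predeqE => X /=; split; apply: isomorphic_trans => //.
exact: isomorphic_sym.
Qed.

(** Converts a pair of labellings with the same type into an actual isomorphism
    between restrictions, the form in which [controls] consumes it. *)
Lemma iso_of_same_type R T (N : Type) (D : set N) (v : N -> R) (w : N -> T) :
  set_inj D v -> set_inj D w -> same_type D v w ->
  exists f : restriction (v @` D) -> restriction (w @` D),
    isomorphism f /\
    forall x d, D d -> sval x = v d -> sval (f x) = w d.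
Proof.
move=> vinj winj vw.
have /choice[c cP] (x : restriction (v @` D)) : exists d, D d /\ sval x = v d.
  by case: x => x xD; have [d Dd dx] := set_mem xD; exists d.
have wD x : w (c x) \in w @` D by rewrite inE; exists (c x) => //; case: (cP x).
pose f x : restriction (w @` D) := exist _ (w (c x)) (wD x).
have fP x d : D d -> sval x = v d -> sval (f x) = w d.
  move=> Dd xd; rewrite /f /=; congr w; have [Dc xc] := cP x.
  by apply: vinj; rewrite ?inE -?xc.
exists f; split=> //; split.
  apply: inj_surj_bijective => [x y [] wxy|[y yD]].
    have [Dx xc] := cP x; have [Dy yc] := cP y.
    apply: (embedding_sval _).1; rewrite xc yc; congr v.
    by apply: winj; rewrite ?inE.
  have [d Dd dy] := set_mem yD.
  have vD : v d \in v @` D by rewrite inE; exists d.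
  exists (exist _ (v d) vD); apply: (embedding_sval _).1.
  by rewrite (fP _ d).
move=> i t /=.
have -> : sval \o t = v \o (c \o t).
  by apply/funext => j /=; have [_ <-] := cP (t j).
rewrite vw; last by move=> j; case: (cP (t j)).
by have -> : sval \o (f \o t) = w \o (c \o t) by [].
Qed.

(** What monomorphy is used for: since all restrictions to p points are
    isomorphic, the type of an enumeration of p points is that of a fixed
    enumeration [w] composed with a permutation, so at most p! types occur. *)
Lemma monomorphic_same_type R p (v w : nat -> R) : monomorphic R ->
  set_inj `I_p v -> set_inj `I_p w ->
  exists s : nat -> nat, [/\ forall i, i < p -> s i < p, set_inj `I_p s &
    same_type `I_p v (w \o s)].
Proof.
move=> monoR vinj winj.
have [f [fbij fP]] := monoR p (v @` `I_p) (w @` `I_p)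
  (inj_card_eq vinj) (inj_card_eq winj).
have sex i : exists j, i < p -> j < p /\
    forall x, sval x = v i -> sval (f x) = w j.
  case: (ltnP i p) => ip; last by exists 0.
  have vi : v i \in v @` `I_p by rewrite inE; exists i.
  have [j jp jf] := set_mem (proj2_sig (f (exist _ (v i) vi))).
  exists j => _; split=> // x xv; rewrite jf; congr (sval (f _)).
  exact: (embedding_sval _).1.
have [s sP] := choice sex.
have fs i (ip : i < p) x : sval x = v i -> sval (f x) = w (s i).
  by have [_] := sP i ip; apply.
have sp i : i < p -> s i < p by case/sP.
exists s; split=> //.
  move=> i j; rewrite !inE /= => ip jp eij.
  have vi : v i \in v @` `I_p by rewrite inE; exists i.
  have vj : v j \in v @` `I_p by rewrite inE; exists j.
  apply: vinj; rewrite ?inE//.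
  suff : exist _ (v i) vi = exist _ (v j) vj :> restriction _ by case.
  apply: (bij_inj fbij); apply: (embedding_sval _).1.
  by rewrite (fs i)// (fs j)// eij.
move=> i t tp.
have vt j : v (t j) \in v @` `I_p by rewrite inE; exists (t j) => //; apply: tp.
have /= := fP i (fun j => exist _ (v (t j)) (vt j)).
rewrite (_ : sval \o (fun j => exist _ (v (t j)) (vt j)) = v \o t)// => ->.
set u := sval \o _; suff -> : u = (w \o s) \o t by [].
apply/funext => j; rewrite /u /=; apply: fs => //; exact: tp.
Qed.

End Structures.

(** * Iterated ultrafilter quantifiers *)

Section AlmostAll.
Variables (E : Type) (U : set_system E).
Context {UU : UltraFilter U}.
Hypothesis freeU : forall x, U [set y | y <> x].

Lemma ultra_const (P : Prop) : U [set _ | P] <-> P.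
Proof.
split=> [/filter_ex[]//|p].
by apply: filterS (@filterT _ U _) => x _.
Qed.

Lemma ultraN (A : set E) : U (~` A) <-> ~ U A.
Proof.
split=> [UnA UA|nUA]; last by case: (in_ultra_setVsetC A UU).
by have /filter_ex[x []] : U (A `&` ~` A) by exact: filterI.
Qed.

Section Names.
Variable N : eqType.
Implicit Types (s : seq N) (P : (N -> E) -> Prop) (v w : N -> E).

(** The iterated quantifier: for U-almost all values of the first name of [s],
    for U-almost all values of the second one, ..., the valuation so updated
    satisfies [P].  Names outside [s] keep their value under [v].  For fixed [s]
    and [v] this is again an ultrafilter, on valuations. *)
Fixpoint almost_all s P v : Prop :=
  if s is c :: s' then U [set x | almost_all s' P (upd v c x)] else P v.

Lemma almost_all_imp s P P' v : (forall w, P w -> P' w) ->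
  almost_all s P v -> almost_all s P' v.
Proof.
move=> PP'; elim: s v => [|c s IHs] v /=; first exact: PP'.
by apply: filterS => x /=; apply: IHs.
Qed.

Lemma almost_allT s P v : (forall w, P w) -> almost_all s P v.
Proof.
move=> PT; elim: s v => [|c s IHs] v //=.
by rewrite (_ : [set _ | _] = setT); [exact: filterT|rewrite -subTset => x _ /=].
Qed.

Lemma almost_allI s P P' v : almost_all s P v -> almost_all s P' v ->
  almost_all s (fun w => P w /\ P' w) v.
Proof.
elim: s v => [|c s IHs] v //= UP UP'.
by apply: filterS2 UP UP' => x /=; apply: IHs.
Qed.

Lemma almost_all_ex s P v : almost_all s P v -> exists w, P w.
Proof.
elim: s v => [|c s IHs] v /=; first by exists v.
by case/filter_ex => x; apply: IHs.
Qed.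

Lemma almost_allN s P v : almost_all s (fun w => ~ P w) v <-> ~ almost_all s P v.
Proof.
elim: s v => [|c s IHs] v //=; rewrite -ultraN.
by split; apply: filterS => x /=; rewrite /setC/= IHs.
Qed.

(** An ultrafilter that contains a finite union contains one of the pieces. *)
Lemma almost_all_pigeonhole (F : finType) s (P : F -> (N -> E) -> Prop) v :
  almost_all s (fun w => exists k, P k w) v ->
  exists k, almost_all s (P k) v.
Proof.
move=> UP; apply: contrapT => /forallNP nUP.
have UN : almost_all s (fun w => forall k, k \in enum F -> ~ P k w) v.
  elim: (enum F) => [|k ks IHks]; first exact: almost_allT.
  have := almost_allI (iffRL (almost_allN _ _ _) (nUP k)) IHks.
  apply: almost_all_imp => w [nPk nPks] l.
  by rewrite inE => /predU1P[->//|/nPks].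
have [w [[k Pk]]] := almost_all_ex (almost_allI UP UN).
by move=> /(_ k); rewrite mem_enum; apply.
Qed.

(** Since [U] is nonprincipal, each new value almost surely differs from the
    finitely many earlier ones. *)
Lemma almost_all_inj s v : uniq s ->
  almost_all s (fun w => {in s &, injective w}) v.
Proof.
(* [a] collects the names that have already received a value. *)
suff H : forall a v, uniq (a ++ s) -> {in a &, injective v} ->
    almost_all s (fun w => {in a ++ s &, injective w}) v.
  by move=> us; exact: (H [::]).
elim: s => [|c s IHs] a {}v /=; first by rewrite cats0.
move=> us injv.
have : U [set x | forall d, d \in a -> x <> v d].
  elim: (a) => [|d b IHb]; first by apply: filterS (@filterT _ U _) => x _ d.
  apply: filterS2 (freeU (v d)) IHb => x /= xd xb e.
  by rewrite inE => /predU1P[->//|/xb].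
apply: filterS => x /= xa.
rewrite -cat_rcons; apply: IHs; first by rewrite cat_rcons.
have ca : c \notin a by move: us; rewrite cat_uniq /= => /and3P[_ /norP[]].
move=> d e; rewrite !mem_rcons !inE /upd.
case: (eqVneq d c) => [->|dc]; case: (eqVneq e c) => [->|ec] //=.
- by move=> _ ea /xa.
- by move=> da _ /esym /xa.
- exact: injv.
Qed.

(** Quantifying over a name on which [P] does not depend changes nothing.  This
    is the coherence that makes the type of a subsequence the restriction of the
    type of the whole sequence. *)
Lemma almost_all_filter (p : pred N) s P v w :
  (forall v' w', {in p, v' =1 w'} -> P v' <-> P w') ->
  (forall d, d \in p -> d \notin s -> v d = w d) ->
  almost_all s P v <-> almost_all [seq c <- s | p c] P w.
Proof.
move=> Pp; elim: s v w => [|c s IHs] v w /= vw.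
  by apply: Pp => d dp; apply: vw.
case: ifPn => pc.
  rewrite /=; suff -> : [set x | almost_all s P (upd v c x)] =
    [set x | almost_all [seq x <- s | p x] P (upd w c x)] by [].
  rewrite predeqE => x /=; apply: IHs => d dp ds; rewrite /upd.
  by case: eqVneq => // dc; apply: vw; rewrite // inE negb_or dc.
rewrite -(ultra_const (almost_all _ _ w)).
suff -> : [set x | almost_all s P (upd v c x)] =
    [set _ | almost_all [seq x <- s | p x] P w] by [].
rewrite predeqE => x /=; apply: IHs => d dp ds; rewrite /upd.
case: eqVneq => dc; last by apply: vw; rewrite // inE negb_or dc.
by move: dp pc; rewrite dc unfold_in => ->.
Qed.

End Names.

Lemma almost_all_map (N N' : eqType) (h : N -> N') (D : pred N) (s : seq N)
    (P : (N -> E) -> Prop) (P' : (N' -> E) -> Prop) v v' :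
  (forall w w', {in D, w' \o h =1 w} -> P' w' <-> P w) ->
  (forall c d, c \in s -> d \in D -> h d = h c -> d = c) ->
  (forall d, d \in D -> d \notin s -> v' (h d) = v d) ->
  almost_all (map h s) P' v' <-> almost_all s P v.
Proof.
move=> PP'; elim: s v v' => [|c s IHs] v v' /= hinj vv'.
  by apply: PP' => d dD; apply: vv'.
suff -> : [set x | almost_all (map h s) P' (upd v' (h c) x)] =
  [set x | almost_all s P (upd v c x)] by [].
rewrite predeqE => x /=; apply: IHs => [e d es|d dD ds].
  by apply: hinj; rewrite inE es orbT.
rewrite /upd; case: (eqVneq d c) => [->|dc]; first by rewrite eqxx.
case: eqP => [/(hinj c d (mem_head _ _) dD)/eqP|_]; first by rewrite (negPf dc).
by apply: vv'; rewrite // inE negb_or dc.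
Qed.

End AlmostAll.

Lemma free_ultrafilter (E : Type) : infinite_set [set: E] ->
  exists U : set_system E, UltraFilter U /\ forall x, U [set y | y <> x].
Proof.
move=> /frechet_properfilter FF.
have [U [UU FU]] := ultraFilterLemma FF; exists U; split=> // x.
apply: FU; rewrite /frechet_filter /=.
rewrite (_ : ~` _ = [set x]) //.
by rewrite predeqE => y /=; split => [/contrapT|->].
Qed.

(** * Building an embedding point by point *)

(** [P k v] says that the first [k] values of [v] form a partial solution, and
    [e k v w] that the first [k] values of [v] and of [w] have the same type.
    Finitely many types in each length replace the finite branching of Koenig's
    lemma, although [T] itself is infinite. *)
Section Extension.
Variables (T : Type) (t0 : T).
Variables (P : nat -> (nat -> T) -> Prop) (e : nat -> (nat -> T) -> (nat -> T) -> Prop).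

Hypothesis P_agree : forall k v w, agree k v w -> P k v -> P k w.
Hypothesis P_anti : forall k k' v, k <= k' -> P k' v -> P k v.
Hypothesis P_ex : forall k, exists v, P k v.
Hypothesis P_e : forall k v w, e k v w -> P k v -> P k w.
Hypothesis e_forth : forall k v w, e k v w -> exists y, e k.+1 v (upd w k y).
Hypothesis e_finite : forall k, exists (F : finType) (col : F -> (nat -> T) -> Prop),
  (forall v, P k v -> exists c, col c v) /\
  (forall c v w, col c v -> col c w -> e k v w).

(* [v] restricted to [k] begins arbitrarily long partial solutions. *)
Let good k v := forall m, exists w, agree k w v /\ P (k + m) w.

Let e_forth_iter k v w m : e k v w ->
  exists w', agree k w' w /\ e (k + m) v w'.
Proof.
elim: m => [|m IHm] evw; first by exists w; rewrite addn0.
have [w' [ww' evw']] := IHm evw; have [y ey] := e_forth evw'.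
exists (upd w' (k + m) y); rewrite addnS; split=> // i ik.
by rewrite /upd ltn_eqF ?ww'// ltn_addr.
Qed.

(* One type of sequences of length [k + 1] occurs in arbitrarily long extensions
   of [v]; any representative [w0] of it will do, because the longer extensions
   can be transferred to [w0] by the forth property. *)
Let good_step k v : good k v -> exists x, good k.+1 (upd v k x).
Proof.
move=> gv; have [F [col [colP col_e]]] := e_finite k.+1.
have [c colc] : exists c, forall m,
    exists w, [/\ agree k w v, P (k.+1 + m) w & col c w].
  apply: antitone_pigeonhole => [c m m' mm' [w [wv Pw cw]]|m].
    by exists w; split=> //; apply: P_anti Pw; rewrite leq_add2l.
  have [w [wv Pw]] := gv m.+1; have [|c cw] := colP w.
    by apply: P_anti Pw; lia.
  by exists c, w; split=> //; rewrite addSnnS.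
have [w0 [w0v _ cw0]] := colc 0; exists (w0 k) => m.
have [w [wv Pw cw]] := colc m.
have [w1 [w1w0 ew1]] := e_forth_iter m (col_e _ _ _ cw cw0).
exists w1; split; last exact: P_e ew1 Pw.
move=> i ik; rewrite w1w0// /upd; case: eqVneq => [->//|ik'].
by apply: w0v; lia.
Qed.

(** Iterating [good_step] keeps all finite sections of the limit extendable to
    partial solutions, so the sections themselves are partial solutions. *)
Lemma extension : exists f : nat -> T, forall k, P k f.
Proof.
have g0 : good 0 (fun=> t0) by move=> m; have [w Pw] := P_ex m; exists w.
pose X := {kv : nat * (nat -> T) | good kv.1 kv.2}.
pose next (a b : X) := exists x,
  sval b = ((sval a).1.+1, upd (sval a).2 (sval a).1 x).
have nextP (a : X) : {b : X | next a b}.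
  apply: cid; case: a => -[k v] /= gv; have [x gx] := good_step gv.
  by exists (exist (fun kv => good kv.1 kv.2) (k.+1, upd v k x) gx), x.
have [f [f0 fS]] := dependent_choice nextP
  (exist (fun kv => good kv.1 kv.2) (0, fun=> t0) g0).
have fk k : (sval (f k)).1 = k.
  elim: k => [|k IHk]; first by rewrite f0.
  by have [x ->] := fS k; rewrite IHk.
pose g k := (sval (f k.+1)).2 k.
have fg k : agree k (sval (f k)).2 g.
  elim: k => [|k IHk] i //; rewrite ltnS leq_eqVlt => /predU1P[->//|ik].
  have [x ->] := fS k; rewrite /= fk /upd ltn_eqF//.
  exact: IHk.
exists g => k; apply: P_agree (fg k) _.
have := proj2_sig (f k); rewrite fk => /(_ 0)[w [wf Pw]].
by apply: P_agree wf _; rewrite addn0 in Pw.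
Qed.

End Extension.

(** * Orbits of a monomorphic uniformly prehomogeneous structure *)

Section Orbits.
Variables (I : Type) (n : I -> nat) (R : structure n) (r : nat -> R).
Hypothesis r_inj : injective r.
Hypothesis monoR : monomorphic R.
Hypothesis uprehR : uniformly_prehomogeneous R.

Definition same_orbit k (v w : nat -> R) :=
  exists g : R -> R, isomorphism g /\ forall i, i < k -> g (v i) = w i.

(** Aut(R) has finitely many orbits on injective [k]-tuples.  Extend a tuple [v]
    to an enumeration [w] of a set controlling it, of size at most [theta k].
    Tuples whose extensions have the same labelled type are related by a local
    isomorphism that extends to the controlling set, hence by an automorphism.
    By monomorphy a labelled type is coded by a permutation relative to the fixed
    enumeration [r], and there are finitely many codes. *)
Lemma same_orbit_finite k : exists (F : finType) (col : F -> (nat -> R) -> Prop),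
  (forall v, set_inj `I_k v -> exists c, col c v) /\
  (forall c v w, col c v -> col c w -> same_orbit k v w).
Proof.
have [theta thetaP] := uprehR.
set b := theta k.
(* A colour is the size of the controlling set with a permutation of its
   indices; permutations of all sizes up to [b] live in a single type. *)
pose col (c : 'I_b.+1 * {ffun 'I_b.+1 -> 'I_b.+1}) (v : nat -> R) :=
  exists w, [/\ k <= c.1, agree k w v, set_inj `I_c.1 w,
    controls (v @` `I_k) (w @` `I_c.1) &
    same_type `I_c.1 w (fun i => r (c.2 (inord i)))].
exists _, col; split=> [v vinj|[p s] v w [v' /= [kp v'v v'inj ctr v's]]
    [w' /= [_ w'w w'inj _ w's]]].
  have [F [vF Fb ctr]] := thetaP k (v @` `I_k) (inj_card_eq vinj).
  have [p [w [/andP[kp pb] wv winj wF]]] := extend_enumeration Fb vinj vF.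
  have [s [sp _ ws]] := monomorphic_same_type monoR winj
    (in2W r_inj : set_inj `I_p r).
  have pb1 : p < b.+1 by [].
  exists (Ordinal pb1, [ffun i : 'I_b.+1 => inord (s i)]), w; split=> //=.
    by rewrite wF.
  move=> i t tp; rewrite ws//.
  set u := _ \o t; set u' := _ \o t; suff -> : u = u' by [].
  apply/funext => j; rewrite /u /u' /= ffunE.
  have := tp j; rewrite /= => tjp; have := sp _ tjp => stp.
  by rewrite !inordK//; lia.
have sub (x : nat -> R) : `I_k `<=` `I_p by move=> i /= ik; apply: leq_trans kp.
have vw : same_type `I_p v' w' by move=> i t tp; rewrite v's// w's.
have vw0 : same_type `I_k v w.
  move=> i t tk; have : forall j, `I_p (t j) by move=> j; apply: sub.
  move=> /vw; rewrite (_ : v' \o t = v \o t); last first.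
    by apply/funext => j /=; apply: v'v; apply: tk.
  by rewrite (_ : w' \o t = w \o t)//; apply/funext => j /=; apply: w'w; apply: tk.
have inj0 (x x' : nat -> R) : agree k x' x -> set_inj `I_p x' -> set_inj `I_k x.
  move=> xx' x'inj i j; rewrite !inE => ik jk eij.
  by apply: x'inj; rewrite ?inE ?xx'//; apply: sub.
have [f [fiso fP]] := iso_of_same_type (inj0 _ _ v'v v'inj) (inj0 _ _ w'w w'inj) vw0.
have [h [hiso hP]] := iso_of_same_type v'inj w'inj vw.
have [|g giso gP] := ctr _ f fiso.
  exists (w' @` `I_p), h; split=> // x y xy.
  have [i ik iy] := set_mem (proj2_sig x).
  rewrite /Defs.incl (fP x i)// -(w'w i ik); apply: hP; first exact: sub.
  by move: xy; rewrite /Defs.incl => <-; rewrite v'v.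
exists g; split=> // i ik.
have vi : v i \in v @` `I_k by rewrite inE; exists i.
by have := gP (exist _ (v i) vi); rewrite /Defs.incl (fP _ i).
Qed.

End Orbits.

(** * Stretching a structure along a chain *)

Section Stretching.
Variables (I : Type) (n : I -> nat) (R : structure n) (U : set_system R).
Context {UU : UltraFilter U}.
Hypothesis freeU : forall x, U [set y | y <> x].
Variable e0 : R.
Let l0 : L := (0%R, 0).

(** The carrier is written [rat * nat]: the type of all ordered types lives above
    the universe of [structure], so the chain cannot be an abstract one. *)
Definition stretch : structure n :=
  @Structure I n (rat * nat)%type (fun i => [set t : 'I_(n i) -> L |
    almost_all U (sort <=%O (undup (codom t)))
      (fun v => rho R i (v \o t)) (fun=> e0)]).

(** Any increasing sequence that contains the entries of [t] may serve to
    evaluate a relation, not just the shortest one. *)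
Lemma stretch_sorted s i (t : 'I_(n i) -> L) v :
  sorted <%O s -> (forall j, t j \in s) ->
  rho stretch i t <-> almost_all U s (fun v => rho R i (v \o t)) v.
Proof.
move=> ss ts.
have -> : rho stretch i t =
  almost_all U [seq c <- s | c \in codom t]
    (fun v => rho R i (v \o t)) (fun=> e0).
  congr almost_all; apply: lt_sorted_eq.
  - by rewrite sort_lt_sorted undup_uniq.
  - exact: lt_sorted_filter.
  move=> c; rewrite mem_sort mem_undup mem_filter.
  by case: (boolP (c \in codom t)) => // /codomP[j ->]; rewrite ts.
apply: iff_sym; apply: almost_all_filter => [v' w' vw|d /codomP[j ->]].
  suff -> : v' \o t = w' \o t by [].
  by apply/funext => j /=; apply: vw; exact: codom_f.
by rewrite ts.
Qed.

Lemma stretch_map (h : L -> L) s i (t : 'I_(n i) -> L) v :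
  {in s &, injective h} -> (forall j, t j \in s) ->
  almost_all U (map h s) (fun v => rho R i (v \o (h \o t))) v <->
  almost_all U s (fun v => rho R i (v \o t)) v.
Proof.
move=> hinj ts; apply: (@almost_all_map _ _ _ _ h (mem s)).
- move=> w w' ww'; suff -> : w' \o (h \o t) = w \o t by [].
  by apply/funext => j /=; apply: ww'; exact: ts.
- by move=> c d cs ds; apply: hinj.
- by move=> d /= ->.
Qed.

(** The chain [L] freely interprets the stretched structure: an increasing
    renaming of the entries of [t] maps one evaluation onto the other. *)
Lemma stretch_pattern i (t t' : 'I_(n i) -> L) :
  (forall j k, (t j < t k)%O = (t' j < t' k)%O) ->
  rho stretch i t <-> rho stretch i t'.
Proof.
move=> tt'.
have [j k tjk|h ht] := @factor_through _ _ _ l0 t t'.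
  have := tt' j k; have := tt' k j; rewrite tjk ltxx.
  by case: ltgtP.
pose s := sort <=%O (undup (codom t)).
have ts j : t j \in s by rewrite mem_sort mem_undup codom_f.
have ss : sorted <%O s by rewrite sort_lt_sorted undup_uniq.
have hlt : {in s &, {homo h : c d / (c < d)%O}}.
  move=> c d; rewrite !mem_sort !mem_undup => /codomP[j ->] /codomP[k ->].
  by rewrite tt' -ht.
have hinj : {in s &, injective h}.
  move=> c d cs ds hcd; case: (ltgtP c d) => // /hlt.
    by move=> /(_ cs ds); rewrite hcd ltxx.
  by move=> /(_ ds cs); rewrite hcd ltxx.
rewrite (@stretch_sorted s i t (fun=> e0) ss ts).
rewrite (@stretch_sorted (map h s) i t' (fun=> e0)); last first.
- by move=> j; rewrite -ht; exact: map_f.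
- exact: homo_sorted_in hlt _ ss; apply/allP.
by rewrite -ht; apply: iff_sym; apply: stretch_map.
Qed.

(** The generic type of a sequence of length p is realized, for all relations at
    once although there may be infinitely many of them: valuations have at most
    p! types by monomorphy, so one type is almost sure. *)
Lemma stretch_realized (r : nat -> R) s :
  injective r -> monomorphic R -> sorted <%O s ->
  exists w : L -> R, {in s &, injective w} /\
    @same_type I n R stretch L [set` s] w id.
Proof.
move=> rinj monoR ss; pose p := size s.
(* [typ k v]: up to the permutation [k], the values of [v] along [s] have the type
   of the first [p] values of [r].  Indices live in a nonempty ordinal type so
   that [inord] makes sense when [s] is empty. *)
pose typ (k : {ffun 'I_p.+1 -> 'I_p.+1}) (v : L -> R) :=
  forall i (t : 'I_(n i) -> L), (forall j, t j \in s) ->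
    rho R i (v \o t) <-> rho R i (fun j => r (k (inord (index (t j) s)))).
have us := lt_sorted_uniq ss.
have typP v : {in s &, injective v} -> exists k, typ k v.
  move=> vinj; have [] := @monomorphic_same_type I n R p (v \o nth l0 s) r monoR.
  - move=> i j; rewrite !inE /= => ip jp.
    by move/(vinj _ _ (mem_nth _ ip) (mem_nth _ jp))/eqP; rewrite nth_uniq// => /eqP.
  - exact: in2W.
  move=> sg [sgp _ vsg]; exists [ffun i : 'I_p.+1 => inord (sg i)] => i t ts.
  have := vsg i (fun j => index (t j) s).
  rewrite (_ : _ \o _ \o _ = v \o t); last first.
    by apply/funext => j /=; rewrite nth_index ?ts.
  move=> -> /=; last by move=> j; rewrite index_mem.
  set a := _ \o _; set b := fun j => _; suff -> : a = b by [].
  apply/funext => j; rewrite /a /b /= ffunE.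
  have ip : index (t j) s < p by rewrite index_mem.
  by have sp := sgp _ ip; rewrite !inordK//; apply: leqW.
have UI : almost_all U s (fun w => {in s &, injective w}) (fun=> e0).
  exact: almost_all_inj.
have [k Uk] := almost_all_pigeonhole (almost_all_imp typP UI).
have [w [kw winj]] := almost_all_ex (almost_allI Uk UI).
exists w; split=> // i t ts.
rewrite (@stretch_sorted s i _ (fun=> e0))// (kw i t ts).
split=> [rt|rt].
  by apply: almost_all_imp Uk => v kv; rewrite (kv i t ts).
have [v [kv]] := almost_all_ex (almost_allI Uk rt).
by rewrite (kv i t ts).
Qed.

End Stretching.

(** * Twins and total symmetry *)

Section Twins.
Variables (I : Type) (n : I -> nat).

(** Replacing [x] by [y] in tuples that avoid [y] preserves all relations.  The
    tuple [t'] is the result of the replacement; it is specified rather than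
    computed because the domain has no decidable equality. *)
Definition twins (T : structure n) (x y : T) :=
  forall i (t t' : 'I_(n i) -> T), (forall j, t j <> y) ->
    (forall j, t j = x /\ t' j = y \/ t j <> x /\ t' j = t j) ->
    rho T i t <-> rho T i t'.

Lemma twins_sym (T : structure n) (x y : T) : twins x y -> twins y x.
Proof.
move=> xy i t t' tx tt'.
have [exy|nxy] := pselect (x = y).
  suff -> : t = t' by [].
  by apply/funext => j; have [[ty _]|[]//] := tt' j; case: (tx j); rewrite exy.
apply: iff_sym; apply: xy => j; have [[ty ->]|[nty ->]] := tt' j; by [|auto|].
Qed.

Lemma isomorphism_twins (S T : structure n) (g : S -> T) x y :
  isomorphism g -> twins x y -> twins (g x) (g y).
Proof.
move=> giso xy i t t' ty tt'.
have [h [_ hP] [gh hg]] := iso_inv giso.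
rewrite !hP; apply: xy => j.
  by move=> hty; apply: (ty j); rewrite -hty /= hg.
have [[tx t'y]|[tx t't]] := tt' j; [left|right]; split.
- by rewrite /= tx gh.
- by rewrite /= t'y gh.
- by move=> hx; apply: tx; rewrite -hx /= hg.
- by rewrite /= t't.
Qed.

End Twins.

Section Symmetry.
Variables (I : Type) (n : I -> nat) (R : structure n) (U : set_system R).
Context {UU : UltraFilter U}.
Variable e0 : R.
Let M := stretch U e0.

Definition swap_invariant := forall s1 (u v : L) s2 i (t : 'I_(n i) -> L),
  uniq (s1 ++ u :: v :: s2) -> (forall j, t j \in s1 ++ u :: v :: s2) ->
  almost_all U (s1 ++ u :: v :: s2) (fun v => rho R i (v \o t)) (fun=> e0) ->
  almost_all U (s1 ++ v :: u :: s2) (fun v => rho R i (v \o t)) (fun=> e0).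

Lemma swap_invariant_perm s s' i (t : 'I_(n i) -> L) : swap_invariant ->
  uniq s -> (forall j, t j \in s) -> perm_eq s s' ->
  almost_all U s (fun v => rho R i (v \o t)) (fun=> e0) <->
  almost_all U s' (fun v => rho R i (v \o t)) (fun=> e0).
Proof.
move=> swapU.
have H a b : uniq a -> (forall j, t j \in a) -> perm_eq a b ->
  almost_all U a (fun v => rho R i (v \o t)) (fun=> e0) ->
  almost_all U b (fun v => rho R i (v \o t)) (fun=> e0).
  move=> ua ta ab Ua.
  pose P c := [/\ uniq c, (forall j, t j \in c) &
    almost_all U c (fun v => rho R i (v \o t)) (fun=> e0)].
  have Pb : P b; last by case: Pb.
  apply: (@perm_ind_adjacent _ P _ _ _ ab); last by split.
  move=> s1 u v s2 [us ts Us].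
  have sE : perm_eq (s1 ++ u :: v :: s2) (s1 ++ v :: u :: s2).
    by rewrite perm_cat2l; exact/permPl/(perm_catCA [:: u] [:: v] s2).
  split; last exact: swapU Us.
  - by rewrite -(perm_uniq sE).
  - by move=> j; rewrite -(perm_mem sE).
move=> us ts ss'; split; first exact: H.
apply: H; last by rewrite perm_sym.
- by rewrite -(perm_uniq ss').
- by move=> j; rewrite -(perm_mem ss').
Qed.

(** If the order of quantification is irrelevant, truth in [M] depends only on
    the equality pattern of a tuple, so every injective renaming preserves it; this
    is pulled back along the embedding [f]. *)
Lemma swap_invariant_symmetric (f : R -> M) : swap_invariant -> embedding f ->
  forall g : R -> R, bijective g -> isomorphism g.
Proof.
move=> swapU [finj fP] g gbij; split=> // i t; rewrite !fP.
have [j k /finj tjk|h ht] :=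
  @factor_through _ L L (0%R, 0) (f \o t) (f \o (g \o t)); first by rewrite /= tjk.
rewrite -ht; pose u : 'I_(n i) -> L := f \o t; rewrite -[f \o t]/u.
pose s : seq L := sort <=%O (undup (codom u)).
have us j : u j \in s by rewrite mem_sort mem_undup codom_f.
have ss : sorted <%O s by rewrite sort_lt_sorted undup_uniq.
have hinj : {in s &, injective h}.
  move=> c d; rewrite !mem_sort !mem_undup => /codomP[j ->] /codomP[k ->].
  rewrite -![h (u _)]/((h \o u) _) ht /= => /finj/(bij_inj gbij).
  by rewrite /u /= => ->.
have uhs : uniq (map h s) by rewrite map_inj_in_uniq// lt_sorted_uniq.
have hus j : (h \o u) j \in map h s by exact: map_f.
rewrite (stretch_sorted e0 (fun=> e0) ss us).
rewrite (@stretch_sorted _ _ _ _ _ e0 (sort <=%O (map h s)) _ _ (fun=> e0)).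
- rewrite -(stretch_map _ _ hinj us); apply: swap_invariant_perm => //.
  by rewrite perm_sym perm_sort.
- by rewrite sort_lt_sorted.
- by move=> j; rewrite mem_sort.
Qed.

(** Map the names [s1, u, v, s2] to the increasing sequence [a, x, z, b].
    Replacing [x] by [y] yields the values of the increasing sequence [a, z, y, b]
    in which [u] now comes after [v]: twins turn one evaluation into the other. *)
Lemma twins_swap_invariant (A : set L) (x y : @restriction I n M A) (z : L) :
  twins x y ->
  (forall m m', exists a b, [/\ size a = m, size b = m',
     sorted <%O (a ++ (sval x : L) :: z :: (sval y : L) :: b) &
     forall c, c \in a ++ (sval x : L) :: z :: (sval y : L) :: b -> A c]) ->
  swap_invariant.
Proof.
case: x y => [x xA] [y yA] /=.
set X := exist _ x xA; set Y := exist _ y yA => tw ab s1 u v s2 i t ul tl.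
have [a [b [sa sb sab abA]]] := ab (size s1) (size s2).
pose l := s1 ++ u :: v :: s2; pose l' := s1 ++ v :: u :: s2.
pose k := a ++ x :: z :: b; pose k' := a ++ z :: y :: b.
pose h (c : L) : L := nth x k (index c l).
pose h' (c : L) : L := if c == u then y else h c.
have hl : map h l = k by apply: map_nth_index; rewrite // !size_cat /= sa sb.
have : map h l == k by apply/eqP.
rewrite map_cat eqseq_cat ?size_map//= !eqseq_cons.
move=> /and4P[/eqP h1 /eqP hu /eqP hv /eqP h2].
have h's c : c != u -> h' c = h c by rewrite /h' => /negPf ->.
have [us1 vs1 us2 vu] : [/\ u \notin s1, v \notin s1, u \notin s2 & v != u].
  move: (ul); rewrite cat_uniq /= => /and3P[_ /norP[us1 /norP[vs1 _]] /andP[]].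
  by rewrite inE negb_or => /andP[uv us2] _; split=> //; rewrite eq_sym.
have h'l' : map h' l' = k'.
  rewrite map_cat /= [h' u]/h' eqxx h's// hv; congr (_ ++ _ :: _ :: _).
    by rewrite -h1; apply/eq_in_map => c cs; apply: h's; apply: contraNneq us1 => <-.
  by rewrite -h2; apply/eq_in_map => c cs; apply: h's; apply: contraNneq us2 => <-.
have sub s : subseq s (a ++ x :: z :: y :: b) -> sorted <%O s.
  by move=> sk; exact: subseq_lt_sorted sk sab.
have sk : sorted <%O k.
  apply: sub; rewrite subseq_cat2l -[x :: z :: b]/([:: x; z] ++ b).
  by rewrite -[x :: z :: y :: b]/([:: x; z] ++ (y :: b)) subseq_cat2l subseq_cons.
have sk' : sorted <%O k'.
  by apply: sub; rewrite subseq_cat2l; exact: subseq_cons.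
have hinj : {in l &, injective h}.
  by apply: inj_of_uniq_map; rewrite hl lt_sorted_uniq.
have h'inj : {in l' &, injective h'}.
  by apply: inj_of_uniq_map; rewrite h'l' lt_sorted_uniq.
have ll' : l =i l' by move=> c; rewrite !mem_cat !inE (orbCA (c == u)).
have tl' j : t j \in l' by rewrite -ll'.
have kt j : h (t j) \in k by rewrite -hl map_f.
have k't j : h' (t j) \in k' by rewrite -h'l' map_f.
have kA c : c \in k -> c \in A.
  move=> ck; rewrite inE; apply: abA; move: ck.
  by rewrite !mem_cat !inE => /or4P[] ->; rewrite ?orbT.
have k'A c : c \in k' -> c \in A.
  move=> ck; rewrite inE; apply: abA; move: ck.
  by rewrite !mem_cat !inE => /or4P[] ->; rewrite ?orbT.
move=> /(stretch_map U (fun=> e0) hinj tl); rewrite hl.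
move=> /(stretch_sorted e0 _ sk kt) Mht.
apply/(stretch_map U (fun=> e0) h'inj tl'); rewrite h'l'.
apply/(stretch_sorted e0 _ sk' k't).
pose T j : @restriction I n M A := exist _ (h (t j)) (kA _ (kt j)).
pose T' j : @restriction I n M A := exist _ (h' (t j)) (k'A _ (k't j)).
have yk : y \notin k.
  have := lt_sorted_uniq sab; rewrite -[x :: z :: y :: b]/([:: x; z] ++ y :: b).
  by rewrite catA -[y :: b]cat1s uniq_catCA cat1s cons_uniq -catA => /andP[].
have Ty j : T j <> Y by move=> [hy]; move: yk; rewrite -hy kt.
have h'u : h' u = y by rewrite /h' eqxx.
have TT' j : T j = X /\ T' j = Y \/ T j <> X /\ T' j = T j.
  have [tu|tu] := eqVneq (t j) u.
    by left; split; apply: val_inj; rewrite /= tu.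
  right; split; last by apply: val_inj; rewrite /= h's.
  move=> [htx]; move: tu; apply/negP/negPn/eqP.
  by apply: hinj; rewrite ?htx// mem_cat mem_head orbT.
exact: (tw i T T' Ty TT').1 Mht.
Qed.

End Symmetry.

(** * The stretched structure and the original embed in each other *)

Section Prefixes.
Variables (I : Type) (n : I -> nat) (S T : structure n) (s : nat -> S).

Definition prefix_embedding k (f : nat -> T) :=
  set_inj `I_k f /\ same_type `I_k s f.

Lemma prefix_embedding_agree k f g :
  agree k f g -> prefix_embedding k f -> prefix_embedding k g.
Proof.
move=> fg [finj fP]; split=> [i j|i t tk].
  rewrite !inE /= => ik jk; rewrite -!fg// => fij.
  by apply: finj; rewrite ?inE.
rewrite fP//; suff -> : f \o t = g \o t by [].
by apply/funext => j /=; apply: fg; apply: tk.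
Qed.

Lemma prefix_embedding_anti k k' f :
  k <= k' -> prefix_embedding k' f -> prefix_embedding k f.
Proof.
move=> kk' [finj fP]; split=> [i j|i t tk].
  by rewrite !inE /= => ik jk; apply: finj; rewrite inE /=; lia.
by apply: fP => j; have /= := tk j; lia.
Qed.

Lemma embedding_of_prefixes (f : nat -> T) : bijective s ->
  (forall k, prefix_embedding k f) -> exists2 g, embedding g & g \o s = f.
Proof.
move=> [s' ss' s's] fP.
have finj : injective f.
  move=> i j fij; have [finj _] := fP (maxn i j).+1.
  by apply: finj => //; rewrite inE /=; lia.
exists (f \o s'); last by apply/funext => i /=; rewrite ss'.
split=> [|i t]; first exact: inj_comp finj (can_inj s's).
pose k := \max_j (s' (t j)).+1.
have [_ /(_ i (s' \o t))] := fP k.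
rewrite (_ : s \o _ = t); last by apply/funext => j /=.
by apply => j /=; exact: (leq_bigmax (F := fun j => (s' (t j)).+1)).
Qed.

End Prefixes.

Section Age.
Variables (I : Type) (n : I -> nat) (R : structure n) (U : set_system R).
Context {UU : UltraFilter U}.
Hypothesis freeU : forall x, U [set y | y <> x].
Variables (r : nat -> R).
Hypothesis r_bij : bijective r.
Hypothesis monoR : monomorphic R.
Variable e0 : R.
Let M := stretch U e0.
Let r_inj : injective r := bij_inj r_bij.

Lemma stretch_age (s : seq L) : uniq s ->
  exists w : L -> R, {in s &, injective w} /\ @same_type I n R M L [set` s] w id.
Proof.
move=> us; have [|w [winj ws]] :=
  @stretch_realized _ _ _ _ _ freeU e0 r (sort <=%O s) r_inj monoR.
  by rewrite sort_lt_sorted.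
exists w; split=> [c d cs ds|i t ts]; first by apply: winj; rewrite mem_sort.
by apply: ws => j; rewrite /= mem_sort; apply: ts.
Qed.

(** The extension argument with the orbits of Aut(R) as types; partial embeddings
    exist in each length by [stretch_realized]. *)
Lemma stretch_embeds (s : nat -> M) : bijective s -> uniformly_prehomogeneous R ->
  exists f : M -> R, embedding f.
Proof.
move=> s_bij uprehR; have sinj := bij_inj s_bij.
have [f fP] : exists f, forall k, prefix_embedding s k (f : nat -> R).
  apply: (@extension _ (r 0) _ (@same_orbit _ _ R)).
  - exact: prefix_embedding_agree.
  - exact: prefix_embedding_anti.
  - move=> k; pose l : seq L := mkseq s k.
    have [|w [winj wl]] := @stretch_age l.
      by rewrite map_inj_uniq ?iota_uniq.
    have sl i : i < k -> s i \in l by move=> ik; rewrite map_f// mem_iota.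
    exists (w \o s); split=> [i j|i t tk].
      by rewrite !inE /= => ik jk /(winj _ _ (sl _ ik) (sl _ jk))/sinj.
    by apply: iff_sym; apply: wl => j; apply: sl; apply: tk.
  - move=> k v w [g [giso gP]] [vinj vs]; have [gbij gR] := giso.
    split=> [i j|i t tk].
      rewrite !inE /= => ik jk; rewrite -!gP// => /(bij_inj gbij).
      by move=> vij; apply: vinj; rewrite ?inE.
    rewrite vs// gR; suff -> : g \o (v \o t) = w \o t by [].
    by apply/funext => j /=; apply: gP; apply: tk.
  - move=> k v w [g [giso gP]]; exists (g (v k)), g; split=> // i.
    by rewrite ltnS leq_eqVlt /upd => /predU1P[->|ik]; rewrite ?eqxx// ltn_eqF// gP.
  - move=> k; have [F [col [colP col_e]]] := same_orbit_finite r_inj monoR uprehR k.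
    by exists F, col; split=> // v [/colP].
by have [g gP _] := embedding_of_prefixes s_bij fP; exists g.
Qed.

(** The extension argument for maps into the chain of rationals, with order
    patterns as types.  A partial embedding of the first [k] points of [R] exists
    because, by monomorphy, they are in some order [sg] a generic sequence. *)
Lemma embeds_stretch : exists f : R -> M, embedding f /\ forall x, (f x).2 = 0.
Proof.
have [f fP] : exists f : nat -> rat, forall k,
    prefix_embedding r k (fun i => (f i, 0) : M).
  apply: (@extension _ 0%R _ (fun k (v w : nat -> rat) =>
    forall i j, i < k -> j < k -> (v i < v j)%R = (w i < w j)%R)).
  - move=> k v w vw; apply: prefix_embedding_agree => i ik.
    by rewrite vw.
  - by move=> k k' v; apply: prefix_embedding_anti.
  - move=> k; pose a i : L := (i%:R%R, 0).
    have ainj : injective a by move=> i j [/eqP]; rewrite eqr_nat => /eqP.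
    have [|w [winj wl]] := @stretch_age (mkseq a k).
      by rewrite map_inj_uniq ?iota_uniq.
    have al i : i < k -> a i \in mkseq a k by move=> ik; rewrite map_f// mem_iota.
    have [||sg [sgk sginj rsg]] := @monomorphic_same_type _ _ R k r (w \o a) monoR.
    - exact: in2W.
    - by move=> i j; rewrite !inE /= => ik jk /(winj _ _ (al _ ik) (al _ jk))/ainj.
    exists (fun i => (sg i)%:R%R); split=> [i j|i t tk].
      by move=> ik jk /ainj /(sginj _ _ ik jk).
    rewrite rsg// (wl i (a \o (sg \o t)))// => j.
    by apply: al; apply: sgk; apply: tk.
  - move=> k v w vw [vinj vr]; split=> [i j|i t tk].
      rewrite !inE /= => ik jk [wij]; apply: vinj; rewrite ?inE//; congr pair.
      have := vw i j ik jk; have := vw j i jk ik; rewrite wij ltxx.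
      by case: ltgtP.
    rewrite vr//; apply: stretch_pattern => j j'; rewrite !ltLE /= !ltnn !andbF !orbF.
    by apply: vw; apply: tk.
  - move=> k v w vw.
    (* Forth step: [v k] either repeats an earlier value or determines a cut. *)
    have [[i ik vi]|nv] := pselect (exists2 i, i < k & v i = v k).
      exists (w i) => a b; rewrite !ltnS /upd.
      case: (eqVneq a k) => [->|ak]; case: (eqVneq b k) => [->|bk] ak' bk'.
      - by rewrite !ltxx.
      - by rewrite -vi vw//; lia.
      - by rewrite -vi vw//; lia.
      - by rewrite vw//; lia.
    pose lo := [seq w i | i <- iota 0 k & (v i < v k)%R].
    pose hi := [seq w i | i <- iota 0 k & (v k < v i)%R].
    have [|y [loy yhi]] := @rat_between lo hi.
      move=> a b /mapP[i]; rewrite mem_filter mem_iota /= => /andP[ivk ik] ->.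
      move=> /mapP[j]; rewrite mem_filter mem_iota /= => /andP[kvj jk] ->.
      by rewrite -vw//; exact: lt_trans kvj.
    have side i : i < k -> (v i < v k)%R = (w i < y)%R /\ (v k < v i)%R = (y < w i)%R.
      move=> ik; case: (ltgtP (v i) (v k)) => [lt|gt|e].
      - have lty : (w i < y)%R by apply: loy; rewrite map_f// mem_filter lt mem_iota.
        by rewrite lty ltNge ltW.
      - have gty : (y < w i)%R by apply: yhi; rewrite map_f// mem_filter gt mem_iota.
        by rewrite gty ltNge ltW.
      - by case: nv; exists i.
    exists y => a b; rewrite !ltnS /upd.
    case: (eqVneq a k) => [->|ak]; case: (eqVneq b k) => [->|bk] ak' bk'.
    - by rewrite !ltxx.
    - by apply: (side b _).2; lia.
    - by apply: (side a _).1; lia.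
    - by apply: vw; lia.
  - move=> k; exists {ffun 'I_k * 'I_k -> bool}.
    exists (fun (c : {ffun 'I_k * 'I_k -> bool}) (v : nat -> rat) =>
      forall i j : 'I_k, c (i, j) = (v i < v j)%R); split=> [v _|c v w cv cw i j ik jk].
      by exists [ffun ij : 'I_k * 'I_k => (v ij.1 < v ij.2)%R] => i j; rewrite ffunE.
    by have := cv (Ordinal ik) (Ordinal jk); rewrite cw.
have [g gP gr] := embedding_of_prefixes r_bij fP; exists g; split=> // x.
have [r' rr' r'r] := r_bij; rewrite -(r'r x).
by rewrite -[g _]/((g \o r) _) gr.
Qed.

End Age.

(** * Restrictions distinguished by their twins *)

Section Blocks.
Variables (I : Type) (n : I -> nat) (R : structure n) (U : set_system R).
Context {UU : UltraFilter U}.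
Variable e0 : R.
Let M := stretch U e0.

(** Two distinct rational coordinates leave room for a point [z] in between and
    for any number of points on either side, as [twins_swap_invariant] needs. *)
Lemma twins_same_fibre (A : set L) (x y : @restriction I n M A) :
  ~ swap_invariant U e0 -> (forall c : L, c.2 = 0 -> A c) ->
  twins x y -> (sval x : L).1 = (sval y : L).1.
Proof.
move=> nsym A0; wlog lt : x y / ((sval x : L).1 < (sval y : L).1)%R.
  move=> H xy; case: (ltgtP (sval x : L).1 (sval y : L).1) => // lt.
    exact: H xy.
  by apply/esym/H => //; exact: twins_sym.
move=> xy; case: nsym.
pose z : L := ((((sval x : L).1 + (sval y : L).1) / 2)%R, 0).
have [Ax Ay] : A (sval x) /\ A (sval y).
  by split; [exact: set_mem (proj2_sig x)|exact: set_mem (proj2_sig y)].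
apply: (twins_swap_invariant (z := z) xy) => m m'.
have sxzy : sorted <%O [:: (sval x : L); z; (sval y : L)].
  by rewrite /= andbT !ltLE /=; apply/andP; split; apply/orP; left; lra.
have [a [sa ssa a0]] := extend_left m sxzy.
have [|b [sb ssb b0]] := @extend_right m' (sval y) (a ++ [:: sval x : L; z]).
  by rewrite -cats1 -catA.
exists a, b; split=> //; first by move: ssb; rewrite -catA.
move=> c; rewrite mem_cat !inE => /orP[/a0/A0//|/or4P[/eqP->|/eqP->|/eqP->|/b0/A0]]//.
exact: A0.
Qed.

(** No point of the chain separates [(q, k)] from [(q, k + 1)], so the
    replacement preserves order patterns. *)
Lemma consecutive_twins (A : set L) (x y : @restriction I n M A) q k :
  sval x = (q, k) :> L -> sval y = (q, k.+1) :> L -> twins x y.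
Proof.
move=> xq yq i t t' ty tt'.
rewrite -[rho _ i t]/(rho M i (sval \o t)) -[rho _ i t']/(rho M i (sval \o t')).
apply: stretch_pattern => j j' /=.
have ne (c : @restriction I n M A) : c <> x -> c <> y ->
    (sval c : L).1 = q -> (sval c : L).2 <> k /\ (sval c : L).2 <> k.+1.
  by move=> cx cy cq; split=> ck; [apply: cx|apply: cy]; apply: val_inj;
    rewrite /= ?xq ?yq -cq -ck; case: (sval c).
have gap (p : nat) : p <> k /\ p <> k.+1 ->
    (k < p) = (k.+1 < p) /\ (p < k) = (p < k.+1) by lia.
case: (tt' j) (tt' j') => [[tx ->]|[tx ->]] [[tx' ->]|[tx' ->]].
- by rewrite tx tx' !ltxx.
- rewrite tx xq yq !ltLE /=; have [e|_] := eqVneq q _; last by [].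
  by congr orb; exact: (gap _ (ne _ tx' (ty j') (esym e))).1.
- rewrite tx' xq yq !ltLE /=; have [e|_] := eqVneq _ q; last by [].
  by congr orb; exact: (gap _ (ne _ tx (ty j) e)).2.
- by [].
Qed.

(** The fibre over the natural number [m] has [m + 2] points if [m] lies in [S];
    all other fibres are singletons. *)
Definition blocks (S : set nat) : set L :=
  [set c | c.2 = 0 \/ exists m, [/\ S m, c.1 = m%:R%R & c.2 <= m.+1]].

Let block S := @restriction I n M (blocks S).

(** The fibre over [m] is a path of twins, so its image stays inside one fibre.
    That fibre has at least two points, hence lies over some [m'] in [T], and
    comparing sizes gives [m <= m']. *)
Lemma block_image S T (g : block S -> block T) m :
  ~ swap_invariant U e0 -> isomorphism g -> S m ->
  exists m', [/\ T m', m <= m' & forall x, (sval x : L).1 = m%:R%R ->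
    (sval (g x) : L).1 = m'%:R%R].
Proof.
move=> nsym giso Sm.
have B0 (c : L) : c.2 = 0 -> blocks T c by left.
have xB k : ((m%:R%R, minn k m.+1) : L) \in blocks S.
  by rewrite inE; right; exists m; split=> //=; exact: geq_minr.
(* [x 0], ..., [x m.+1] run through the fibre; [minn] makes [x] total. *)
pose x k : block S := exist (fun c => c \in blocks S) _ (xB k).
have gx k : (sval (g (x k)) : L).1 = (sval (g (x 0)) : L).1.
  elim: k => [//|k <-]; have [km|mk] := ltnP k m.+1; last first.
    congr (fst (sval (g _))); apply: val_inj => /=; congr pair.
    by rewrite !(minn_idPr _)//; exact: leqW.
  apply/esym/twins_same_fibre => //; apply: isomorphism_twins => //.
  apply: (@consecutive_twins _ _ _ m%:R%R k) => /=.
    by rewrite (minn_idPl _)//; exact: ltnW.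
  by rewrite (minn_idPl _).
have gx_inj k l : k < m.+2 -> l < m.+2 ->
    (sval (g (x k)) : L).2 = (sval (g (x l)) : L).2 -> k = l.
  move=> km lm kl.
  have /(bij_inj giso.1) : g (x k) = g (x l).
    apply: val_inj; move: (gx k) kl; rewrite -(gx l) /=.
    by case: (sval (g (x k))) => [? ?]; case: (sval (g (x l))) => [? ?] /= -> ->.
  by case; rewrite !(minn_idPl _).
have [m' [Tm' qm']] : exists m', T m' /\ (sval (g (x 0)) : L).1 = m'%:R%R.
  have : (sval (g (x 0)) : L).2 <> (sval (g (x 1)) : L).2 by move/(gx_inj 0 1 isT isT).
  have [|[m' [Tm' qm' _]] _] := set_mem (proj2_sig (g (x 0))); last by exists m'.
  move=> -> ; have [->//|[m' [Tm' qm' _]] _] := set_mem (proj2_sig (g (x 1))).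
  by exists m'; rewrite -(gx 1).
have le k : (sval (g (x k)) : L).2 <= m'.+1.
  have [->//|[m'' [_]]] := set_mem (proj2_sig (g (x k))).
  by rewrite gx qm' => /eqP; rewrite eqr_nat => /eqP ->.
exists m'; split=> //.
  pose f (k : 'I_m.+2) : 'I_m'.+2 := Ordinal (le k : _ < m'.+2).
  have /leq_card : injective f by move=> k l [/gx_inj kl]; apply: val_inj; exact: kl.
  by rewrite !card_ord.
move=> y ym; rewrite -qm' -(gx (sval y : L).2); congr (fst (sval (g _))).
apply: val_inj => /=.
have ym1 : (sval y : L).2 <= m.+1.
  have [->//|[m'' [_]]] := set_mem (proj2_sig y).
  by rewrite ym => /eqP; rewrite eqr_nat => /eqP ->.
by rewrite (minn_idPl ym1) -ym; case: (sval y).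
Qed.

(** The inverse isomorphism maps the fibre over [m'] back to that over [m], which
    forces [m' <= m]. *)
Lemma blocks_subset S T : ~ swap_invariant U e0 ->
  isomorphic (block S) (block T) -> S `<=` T.
Proof.
move=> nsym [g giso] m Sm.
have [h hiso [gh _]] := iso_inv giso.
have [m' [Tm' mm' gm]] := block_image nsym giso Sm.
have [m'' [_ m'm'' hm']] := block_image nsym hiso Tm'.
have xB : ((m%:R%R, 0) : L) \in blocks S by rewrite inE; left.
pose x : block S := exist (fun c => c \in blocks S) _ xB.
have := hm' (g x) (gm x erefl); rewrite gh /= => /eqP; rewrite eqr_nat => /eqP mm''.
by have -> : m = m' by lia.
Qed.

End Blocks.

(** * Counting siblings *)

Lemma sib_le (I : Type) (n : I -> nat) (R : structure n) :
  [set: R] #= [set: nat] -> sib R #<= [set: set nat].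
Proof.
move=> /card_set_of_sets; apply: card_le_trans.
apply: card_le_trans (card_image_le (fun A : set R => iso_class (restriction A)) _).
apply: subset_card_le => _ [S [[A SA] _] <-].
by exists A => //; apply/iso_class_eq; exact: isomorphic_sym.
Qed.

Theorem theorem3p1 (I : Type) (n : I -> nat) (R : structure n) :
  [set: R] #= [set: nat] ->
  monomorphic R ->
  uniformly_prehomogeneous R ->
  Aut R <> [set f : R -> R | bijective f] ->
  sib R #= [set: set nat].
Proof.
move=> cardR monoR uprehR AutR.
have [r r_bij] := enumeration cardR.
have [|U [UU freeU]] := @free_ultrafilter R.
  move=> /card_le_finite finR; apply: infinite_nat; apply: finR.
  by case/card_eqPle: cardR.
pose M := stretch U (r 0).
have [s s_bij] := lexQ_enumeration.
have [j j_emb] := @stretch_embeds _ _ R U UU freeU r r_bij monoR (r 0) s s_bij uprehR.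
have [f [f_emb f0]] := embeds_stretch freeU r_bij monoR (r 0).
have nsym : ~ swap_invariant U (r 0).
  move=> /swap_invariant_symmetric/(_ f_emb) sym; apply: AutR.
  by apply/seteqP; split => g; [case|exact: sym].
pose S_ A := @restriction I n M (blocks A).
have S_sib A : sibling R (S_ A).
  split; apply/embedsP.
    by eexists; exact: embedding_comp (embedding_sval _) j_emb.
  have fA x : f x \in blocks A by rewrite inE; left.
  exists (fun x => exist _ (f x) (fA x)); split; last exact: f_emb.2.
  by move=> x y [/f_emb.1].
rewrite card_eq_le sib_le//=.
pose F A := iso_class (S_ A).
have F_inj : set_inj [set: set nat] F.
  move=> A B _ _ /iso_class_eq AB; apply/seteqP.
  by split; apply: (blocks_subset nsym); last exact: isomorphic_sym.
have /card_eqPle[_ leF] := inj_card_eq F_inj.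
apply: card_le_trans leF _; apply: subset_card_le => _ [A _ <-].
by exists (S_ A); first exact: S_sib.
Qed.
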